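(* Let $\Omega_0,\Omega_1$ be Polish spaces with Borel $\sigma$-algebras, let $\mathcal E\subseteq\Omega_0\times\Omega_1$ be closed with all neighborhoods $N_1(x)$ ($x\in\Omega_0$) and $N_0(y)$ ($y\in\Omega_1$) nonempty, and let $\nu_0,\nu_1$ be finite nonzero measures on $\Omega_0,\Omega_1$. Fix $\iota\in\{0,1\}$ and $\bar\iota=1-\iota$. Let $\vartheta:[0,\infty)\to\mathbb R\cup\{+\infty\}$ be proper, convex, and lower semicontinuous. If $\pi^\star\in\Pi_\iota^{\mathcal E}$ is level-optimal maximin from side $\iota$ to side $\bar\iota$, then $$\mathsf D_\vartheta\bigl(\nu_{\bar\iota}^{(\pi^\star)}\,\|\,\nu_{\bar\iota}\bigr)=\inf_{\pi\in\Pi_\iota^{\mathcal E}}\mathsf D_\vartheta\bigl(\nu_{\bar\iota}^{(\pi)}\,\|\,\nu_{\bar\iota}\bigr).$$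
   Context: Notation. $\mathcal M_+(\Omega)$ is the set of finite nonnegative measures; $T_\#$ is pushforward; $\mathrm{pr}_\iota:\Omega_0\times\Omega_1\to\Omega_\iota$ is the projection. $N_1(x)=\{y\in\Omega_1:(x,y)\in\mathcal E\}$, $N_0(y)=\{x\in\Omega_0:(x,y)\in\mathcal E\}$. Refinements and payloads. $\Pi^{\mathcal E}_\iota=\{\pi\in\mathcal M_+(\Omega_0\times\Omega_1):\pi(\mathcal E^c)=0,\ (\mathrm{pr}_\iota)_\#\pi=\nu_\iota\}$, and $\nu_{\bar\iota}^{(\pi)}=(\mathrm{pr}_{\bar\iota})_\#\pi$. $\vartheta$-divergence. For convex proper $\vartheta:[0,\infty)\to\mathbb R\cup\{+\infty\}$ put $\vartheta'_\infty=\lim_{t\to\infty}\vartheta(t)/t\in\mathbb R\cup\{+\infty\}$. For finite measures $P,Q$ with Lebesgue decomposition $P=rQ+P_\perp$ ($P_\perp\perp Q$), $\mathsf D_\vartheta(P\|Q)=\int\vartheta(r)\,dQ+\vartheta'_\infty P_\perp(\Omega)$, where the last term is $0$ if $P_\perp=0$, and $\mathsf D_\vartheta(P\|Q)=+\infty$ if $\vartheta'_\infty=+\infty$ and $P_\perp\ne0$. Level-optimal maximin. For $\pi\in\Pi^{\mathcal E}_\iota$ let $\nu_{\bar\iota}^{(\pi)}=r\,\nu_{\bar\iota}+P^\perp$ be the Lebesgue decomposition with respect to $\nu_{\bar\iota}$. For $t\ge0$, $\mathsf{Feas}_{\bar\iota}(t)$ is the set of $\sigma\in\mathcal M_+(\Omega_0\times\Omega_1)$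 with $\sigma(\mathcal E^c)=0$, $(\mathrm{pr}_\iota)_\#\sigma\le\nu_\iota$, $(\mathrm{pr}_{\bar\iota})_\#\sigma\le t\,\nu_{\bar\iota}$; $\mathsf{Fit}_{\bar\iota}(t)=\sup\{\sigma(\Omega_0\times\Omega_1):\sigma\in\mathsf{Feas}_{\bar\iota}(t)\}$. $\pi$ is level-optimal maximin from side $\iota$ to side $\bar\iota$ if $\int(r\wedge t)\,d\nu_{\bar\iota}=\mathsf{Fit}_{\bar\iota}(t)$ for every $t>0$. *)

(* Defs.v *)
From HB Require Import structures.
From mathcomp Require Import all_boot all_order all_algebra.
From mathcomp Require Import all_classical all_reals all_analysis.

Set Implicit Arguments.
Unset Strict Implicit.
Unset Printing Implicit Defensive.

Import Order.TTheory GRing.Theory Num.Theory.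
Import numFieldNormedType.Exports.

Local Open Scope classical_set_scope.
Local Open Scope ring_scope.
Local Open Scope ereal_scope.

(* "Polish" is a property of the topology: some complete metric induces it. *)
Definition completely_metrizable (R : realType) (T : topologicalType) : Prop :=
  exists dist : T -> T -> R,
    [/\ forall x y, dist x y = 0%R <-> x = y,
        forall x y, dist x y = dist y x,
        forall x y z, (dist x z <= dist x y + dist y z)%R,
        forall x (A : set T), nbhs x A <->
          exists2 e : R, (0 < e)%R & [set y | (dist x y < e)%R] `<=` A &
        forall u : nat -> T,
          (forall e : R, (0 < e)%R ->
             exists N : nat, forall m n : nat, (N <= m)%N -> (N <= n)%N ->
               (dist (u m) (u n) < e)%R) ->
          exists l : T, u @ \oo --> l].

Definition separable (T : topologicalType) : Prop :=
  exists2 D : set T, countable D & dense D.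

Definition polish (R : realType) (T : topologicalType) : Prop :=
  separable T /\ completely_metrizable R T.

(* Measurable types are pointed, hence ptopologicalType; a space carrying a
   nonzero measure is nonempty anyway. *)
Definition borel (T : ptopologicalType) : measurableType (@open T).-sigma := g_sigma_algebraType (@open T).

Section Divergence.
Context {R : realType}.

(* Functions on [0, +oo[ are represented by total functions R -> \bar R whose
   values at negative reals are never constrained nor used. *)
Definition nnproper (theta : R -> \bar R) : Prop :=
  (forall t : R, (0 <= t)%R -> theta t != -oo) /\
  (exists2 t : R, (0 <= t)%R & theta t < +oo).

(* At a = 0 and a = 1 this is trivial because 0 * +oo = 0 in \bar R. *)
Definition nnconvex (theta : R -> \bar R) : Prop :=
  forall a s t : R, (0 <= a <= 1)%R -> (0 <= s)%R -> (0 <= t)%R ->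
    theta (a * s + (1 - a) * t)%R <= a%:E * theta s + (1 - a)%:E * theta t.

(* In the topology of subspace A, points outside A are isolated. *)
Definition nnlsc (theta : R -> \bar R) : Prop :=
  @lower_semicontinuous (subspace (`[0%R, +oo[ : set R)) R theta.

Definition slope_infty (theta : R -> \bar R) : \bar R :=
  lim (theta t * (t^-1)%:E @[t --> +oo%R]).

Context {d : measure_display} {T : measurableType d}.
Implicit Types (P : set T -> \bar R) (Q : {measure set T -> \bar R}).

Definition mutually_singular (Q Q' : {measure set T -> \bar R}) : Prop :=
  exists N : set T, [/\ measurable N, Q N = 0 & Q' (~` N) = 0].

Definition lebesgue_decomposition P Q
    (r : T -> R) (Pperp : {measure set T -> \bar R}) : Prop :=
  [/\ measurable_fun setT r,
      forall x, (0 <= r x)%R,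
      mutually_singular Q Pperp &
      forall A : set T, measurable A ->
        P A = \int[Q]_(x in A) (r x)%:E + Pperp A].

(* A choice of decomposition: it exists for finite P and Q, and is unique up to
   a Q-null modification of r and the values of Pperp off measurable sets. *)
Definition lebesgue_pair P Q : (T -> R) * (set T -> \bar R) :=
  get [set p | exists2 Pperp : {measure set T -> \bar R},
                 p.2 = Pperp :> (set T -> \bar R) &
                 lebesgue_decomposition P Q p.1 Pperp].

Definition density P Q : T -> R := (lebesgue_pair P Q).1.
Definition singular_part P Q : set T -> \bar R := (lebesgue_pair P Q).2.

(* Since +oo * 0 = 0, the last term vanishes when P has no singular part. *)
Definition divergence (theta : R -> \bar R) P Q : \bar R :=
  \int[Q]_x theta (density P Q x) +
  slope_infty theta * singular_part P Q setT.

End Divergence.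

(* The two spaces form a family indexed by bool, with false for the side 0 and
   true for the side 1; the side opposite to i is ~~ i.  The product carries the
   product of the Borel sigma-algebras, which for Polish spaces is the Borel
   sigma-algebra of the product topology. *)
Section Transport.
Context {R : realType} {X : bool -> ptopologicalType}.

Definition plan : Type :=
  {finite_measure set (borel (X false) * borel (X true))%type -> \bar R}.

Definition pr (i : bool) :
    (borel (X false) * borel (X true))%type -> borel (X i) :=
  if i as b return (borel (X false) * borel (X true))%type -> borel (X b)
  then snd else fst.

Definition payload i (pi : plan) : set (borel (X i)) -> \bar R :=
  pushforward pi (pr i).
Arguments payload i pi _ : clear implicits.

Variable E : set (X false * X true).

Definition N1 (x : X false) : set (X true) := [set y | E (x, y)].
Definition N0 (y : X true) : set (X false) := [set x | E (x, y)].

Variable nu : forall i : bool, {finite_measure set borel (X i) -> \bar R}.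

Definition refinement (i : bool) : set plan :=
  [set pi : plan | pi (~` E) = 0 /\
    forall A : set (borel (X i)), measurable A -> payload i pi A = nu i A].

Definition feas (i : bool) (t : R) : set plan :=
  [set s : plan | [/\ s (~` E) = 0,
      forall A : set (borel (X i)), measurable A -> payload i s A <= nu i A &
      forall B : set (borel (X (~~ i))), measurable B ->
        payload (~~ i) s B <= t%:E * nu (~~ i) B]].

Definition fit (i : bool) (t : R) : \bar R :=
  ereal_sup [set (s : plan) setT | s in feas i t].

(* Only used for pi in refinement i. *)
Definition level_optimal (i : bool) (pi : plan) : Prop :=
  forall t : R, (0 < t)%R ->
    \int[nu (~~ i)]_y
      (Num.min (density (payload (~~ i) pi) (nu (~~ i)) y) t)%:E = fit i t.

End Transport.
Arguments payload {R X} i pi _.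

(* Main.v *)
(* Capping a refinement [pi] by keeping, over each receiver [y], the fraction
   [t / max (r y) t] of its mass shows that [int min(r, t)] never exceeds the
   fit at level [t]; hence a level-optimal [pistar] maximizes [int min(r, t)] for
   all levels [t] at once.  As the total payload mass is the same for all
   refinements, [pistar] minimizes the divergence of every hinge [(s - t)^+], so
   of every finite sum of an affine function and nonnegative multiples of
   hinges.  Maxima of finitely many lines are of this form, and a convex lower
   semicontinuous [theta] is the increasing limit of such maxima, their
   asymptotic slopes increasing to the slope of [theta] at infinity; monotone
   convergence concludes. *)
Require Import Defs.
From HB Require Import structures.
From mathcomp Require Import all_boot all_order all_algebra.
From mathcomp Require Import all_classical all_reals all_analysis.
From mathcomp Require Import measurable_realfun ring lra.
Import Order.TTheory GRing.Theory Num.Theory.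
Import numFieldNormedType.Exports.
Local Open Scope classical_set_scope.
Local Open Scope ring_scope.

(** * Sums of hinges *)

Section HingeSums.
Context {R : realType}.
Implicit Types (phi : R -> R) (a b c m s t : R).

(** The term [s - Num.min s t] is the hinge $(s-t)^+$, and the second index records the slope beyond
    all hinges. [hinge_ext] lets functions that agree on $[0,\infty)$ be exchanged, as negative
    arguments carry no meaning. *)
Inductive hinge_sum : (R -> R) -> R -> Prop :=
| hinge_affine a b : hinge_sum (fun s => a + b * s) b
| hinge_add phi m c t : 0 <= c -> 0 <= t -> hinge_sum phi m ->
    hinge_sum (fun s => phi s + c * (s - Num.min s t)) (m + c)
| hinge_ext phi psi m : (forall s, 0 <= s -> phi s = psi s) ->
    hinge_sum phi m -> hinge_sum psi m.

Lemma hinge_sum_increment phi m : hinge_sum phi m ->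
  forall s s', 0 <= s -> s <= s' -> phi s' - phi s <= m * (s' - s).
Proof.
elim=> {phi m} [a b s s' _ _|phi m c t c0 t0 _ IH s s' s0 ss'|
  phi psi m E _ IH s s' s0 ss'].
- lra.
- have := IH _ _ s0 ss'.
  have : c * (s' - Num.min s' t - (s - Num.min s t)) <= c * (s' - s).
    by apply: ler_wpM2l => //; case: (leP s' t); case: (leP s t); lra.
  lra.
- by rewrite -!E ?IH // (le_trans s0).
Qed.

(** [hinge_ext] leaves negative arguments arbitrary, so continuity is stated after clamping to
    $[0,\infty)$. *)
Lemma hinge_sum_continuous phi m : hinge_sum phi m ->
  continuous (fun s => phi (Num.max 0 s)).
Proof.
have cmax : continuous (fun s : R => Num.max 0 s).
  by move=> s; apply: continuous_max; [exact: cvg_cst|exact: cvg_id].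
elim=> {phi m} [a b|phi m c t c0 t0 _ IH|phi psi m E _ IH] s.
- apply: cvgD; first exact: cvg_cst.
  by apply: cvgM; [exact: cvg_cst|exact: cmax].
- apply: cvgD; first exact: IH.
  apply: cvgM; first exact: cvg_cst.
  apply: cvgB; first exact: cmax.
  by apply: continuous_min; [exact: cmax|exact: cvg_cst].
- rewrite (_ : (fun s => _) = (fun s => phi (Num.max 0 s))); first exact: IH.
  by apply/funext => x; rewrite E// le_max lexx.
Qed.

(** Beyond [t] the graph is replaced by a ray of slope [b]. A hinge at [u <= t] is kept and the
    remaining terms are continued with slope [b - c]; a hinge at [u > t] disappears; the affine part
    receives a new hinge at [t] with weight [b - m]. *)
Lemma hinge_sum_truncate phi m b t : hinge_sum phi m -> 0 <= t -> m <= b ->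
  hinge_sum (fun s => phi (Num.min s t) + b * (s - Num.min s t)) b.
Proof.
move=> H; elim: H b => {phi m} [a m|phi m c u c0 u0 _ IH|phi psi m E _ IH] b t0 mb.
- have bm0 : 0 <= b - m by lra.
  have := hinge_add _ _ _ _ bm0 t0 (hinge_affine a m).
  by rewrite (addrC m) subrK; apply: hinge_ext => s s0; ring.
- have [ut|tu] := leP u t.
    have mbc : m <= b - c by lra.
    have := hinge_add _ _ _ _ c0 u0 (IH _ t0 mbc).
    rewrite subrK; apply: hinge_ext => s s0.
    have [st|ts] := leP s t; first by ring.
    by rewrite (min_r ut) (min_r (le_trans ut (ltW ts))); ring.
  have mb' : m <= b by lra.
  apply: hinge_ext (IH _ t0 mb') => s s0.
  by rewrite [Num.min (Num.min s t) u]min_l ?subrr ?mulr0 ?addr0// ge_min (ltW tu) orbT.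
- apply: hinge_ext (IH _ t0 mb) => s s0.
  by rewrite E// le_min s0.
Qed.

(** Since [m <= b], the line minus [phi] is nondecreasing. The maximum is therefore the line
    throughout, or [phi] truncated at a crossing point, or [phi] itself; in the last case
    [m = b]. *)
Lemma hinge_sum_max_line phi m a b : hinge_sum phi m -> m <= b ->
  hinge_sum (fun s => Num.max (phi s) (a + b * s)) b.
Proof.
move=> H mb.
have incr s s' : 0 <= s -> s <= s' ->
    a + b * s - phi s <= a + b * s' - phi s'.
  by move=> s0 ss'; have := hinge_sum_increment _ _ H _ _ s0 ss'; nra.
have [l0|l0] := leP (phi 0) (a + b * 0).
  apply: hinge_ext (hinge_affine a b) => s s0.
  by rewrite max_r//; have := incr _ _ (lexx 0) s0; lra.
have [[t t0 phit]|noT] := pselect (exists2 t, 0 <= t & phi t = a + b * t).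
  apply: hinge_ext (hinge_sum_truncate _ _ _ _ H t0 mb) => s s0.
  have [st|/ltW ts] := leP s t.
    by rewrite max_l ?subrr ?mulr0 ?addr0//; have := incr _ _ s0 st; lra.
  by rewrite max_r; [rewrite phit; ring|have := incr _ _ t0 ts; lra].
have below s : 0 <= s -> a + b * s <= phi s.
  (* The line starts above-bounded by [phi] at 0, so exceeding [phi] at [s] would produce a crossing
     by the intermediate value theorem. *)
  move=> s0; rewrite leNgt; apply/negP => ls; apply: noT.
  pose f x := a + b * Num.max 0 x - phi (Num.max 0 x).
  have cf : continuous f.
    move=> x; apply: cvgB; last exact: (hinge_sum_continuous _ _ H).
    apply: cvgD; first exact: cvg_cst.
    apply: cvgM; first exact: cvg_cst.
    by apply: continuous_max; [exact: cvg_cst|exact: cvg_id].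
  have f0 : f 0 = a + b * 0 - phi 0 by rewrite /f maxxx.
  have fs : f s = a + b * s - phi s by rewrite /f max_r.
  have [||t /[!in_itv]/= /andP[t0 _] ft] := @IVT R f 0 s 0 s0.
  - exact: continuous_subspaceT.
  - by rewrite ge_min le_max f0 fs; apply/andP; split; apply/orP; [left|right]; lra.
  by exists t => //; move: ft; rewrite /f max_r//; lra.
have bm : m = b.
  apply/eqP; rewrite eq_le mb /= leNgt; apply/negP => mltb.
  (* At this point the line would exceed [phi] by at least 1, because [phi s <= phi 0 + m * s]. *)
  pose s := (phi 0 - a + 1) / (b - m).
  have bm0 : 0 < b - m by lra.
  have s0 : 0 <= s by apply: divr_ge0; lra.
  have sE : s * (b - m) = phi 0 - a + 1 by rewrite /s mulfVK// gt_eqF.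
  by have := below _ s0; have := hinge_sum_increment _ _ H _ _ (lexx 0) s0; nra.
by rewrite -bm; apply: hinge_ext H => s s0; rewrite max_l// bm below.
Qed.

Definition line (p : R * R) s := p.1 + p.2 * s.

(** Sorting by decreasing slope puts the steepest line at the head, so the induction always takes
    the maximum with a line at least as steep as the current hinge sum. That [phi] is the maximum is
    expressed by domination and attainment. *)
Lemma hinge_sum_max_lines (L : seq (R * R)) : L != [::] ->
  exists phi m, [/\ hinge_sum phi m,
    forall p, p \in L -> p.2 <= m /\ forall s, 0 <= s -> line p s <= phi s,
    exists2 p, p \in L & m = p.2 &
    forall s, 0 <= s -> exists2 p, p \in L & phi s = line p s].
Proof.
move=> L0; pose r (p q : R * R) := q.2 <= p.2.
suff sorted_case K : K != [::] -> path.sorted r K -> exists phi m,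
    [/\ hinge_sum phi m,
      forall p, p \in K -> p.2 <= m /\ forall s, 0 <= s -> line p s <= phi s,
      exists2 p, p \in K & m = p.2 &
      forall s, 0 <= s -> exists2 p, p \in K & phi s = line p s].
  have [||phi [m [Hphi ub [q qL mq] attained]]] := sorted_case (sort r L).
  - by rewrite -size_eq0 size_sort size_eq0.
  - by apply: sort_sorted => p q; exact: le_total.
  exists phi, m; split => //.
  - by move=> p pL; apply: ub; rewrite mem_sort.
  - by exists q => //; rewrite mem_sort in qL.
  - by move=> s /attained[p pL ->]; exists p => //; rewrite mem_sort in pL.
elim: K => // p [|q K] IH _ /=.
  move=> _; exists (line p), p.2; split; first exact: hinge_affine.
  - by move=> _ /[!inE]/eqP->.
  - by exists p; rewrite ?inE.
  - by move=> s _; exists p; rewrite ?inE.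
move=> /andP[pq qK]; have [//|//|phi [m [Hphi ub [q' q'K mq'] attained]]] := IH.
have mp : m <= p.2.
  rewrite mq'; have : path.path r p (q :: K) by rewrite /= pq.
  rewrite path_sortedE; last by move=> x y z xy yz; exact: le_trans yz xy.
  by case/andP=> /allP/(_ _ q'K).
exists (fun s => Num.max (phi s) (line p s)), p.2; split.
- by case: p mp {pq} => a b; exact: hinge_sum_max_line.
- move=> p' /[1!inE]/orP[/eqP->|/ub[p'm p'phi]].
    by split=> // s s0; rewrite le_max lexx orbT.
  split; first exact: le_trans mp.
  by move=> s s0; rewrite le_max p'phi.
- by exists p; rewrite ?mem_head.
- move=> s s0; case: (leP (phi s) (line p s)) => _.
    by exists p; rewrite ?mem_head.
  by have [p' p'K ->] := attained _ s0; exists p' => //; rewrite inE p'K orbT.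
Qed.

End HingeSums.

(** * Convex functions as limits of hinge sums *)

Lemma lee_by_lower_reals (R : realType) (x y : \bar R) :
  (forall c : R, (c%:E < x)%E -> (c%:E <= y)%E) -> (x <= y)%E.
Proof.
case: x => [x| |] H; last exact: leNye.
- apply/lee_subgt0Pr => e e0; rewrite -EFinB; apply: H.
  by rewrite lte_fin ltrBlDr ltrDl.
- case: y H => [y| |] H; last by have := H 0 (ltry _).
    by have := H (y + 1) (ltry _); rewrite lee_fin gerDl ler10.
  exact: leey.
Qed.

Section AffineMinorants.
Context {R : realType} (theta : R -> \bar R).
Hypotheses (theta_proper : nnproper theta) (theta_convex : nnconvex theta)
  (theta_lsc : nnlsc theta).
Implicit Types (p : R * R) (a b c s t u v x y : R).

Definition affine_minorant p :=
  forall s, 0 <= s -> ((line p s)%:E <= theta s)%E.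

Lemma theta_lsc_ball c s : 0 <= s -> (c%:E < theta s)%E ->
  exists2 e, 0 < e & forall u, 0 <= u -> `|u - s| < e -> (c%:E < theta u)%E.
Proof.
move=> s0 /theta_lsc[V + Vc].
have s0' : `[0, +oo[%classic s by rewrite /= in_itv /= s0.
case: (nbhs_subspaceP (`[0, +oo[%classic : set R) (s : subspace _)) => // _.
move=> /nbhs_ballP[e /= e0 eV]; exists e => // u u0 us; apply/Vc/eV.
  by rewrite /ball /= distrC.
by rewrite /= in_itv /= u0.
Qed.

(** Real upper bounds [x] and [y] replace the values of [theta] at the endpoints, which keeps the
    chord inequality inside the reals. *)
Lemma theta_chord u s v x y : 0 <= u -> u < s -> s < v ->
  (theta u <= x%:E)%E -> (theta v <= y%:E)%E ->
  (theta s <= (((v - s) * x + (s - u) * y) / (v - u))%:E)%E.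
Proof.
move=> u0 us sv ux vy; pose a := (v - s) / (v - u).
have vu0 : 0 < v - u by lra.
have a01 : 0 <= a <= 1 by rewrite /a divr_ge0 ?ler_pdivrMr//; lra.
have v0 : 0 <= v by lra.
have aE : a * (v - u) = v - s by rewrite /a mulfVK// gt_eqF.
have -> : s = a * u + (1 - a) * v by lra.
apply: le_trans (theta_convex _ _ _ a01 u0 v0) _.
have -> : ((v - (a * u + (1 - a) * v)) * x + (a * u + (1 - a) * v - u) * y) /
    (v - u) = a * x + (1 - a) * y by field; rewrite gt_eqF.
have [a0 a1] := andP a01.
rewrite (EFinD (a * x)) !EFinM; apply: leeD; apply: lee_wpmul2l => //.
by rewrite lee_fin subr_ge0.
Qed.

(** By convexity every secant slope from the left into $(s,c)$ is at most every secant slope to the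
    right. The supremum of the left slopes is a valid choice: [u0] makes their set nonempty and [v0]
    bounds it. *)
Lemma minorant_interior u0 s v0 c : 0 <= u0 -> u0 < s -> s < v0 ->
  (theta u0 < +oo)%E -> (theta v0 < +oo)%E -> (c%:E <= theta s)%E ->
  exists b, affine_minorant (c - b * s, b).
Proof.
move=> u00 u0s sv0 fu0 fv0 cs.
have finite t : 0 <= t -> (theta t < +oo)%E -> theta t = (fine (theta t))%:E.
  move=> /theta_proper.1; case: (theta t) => //.
have v00 : 0 <= v0 by lra.
pose S : set R := [set z | exists u x, [/\ 0 <= u, u < s, (theta u <= x%:E)%E &
  z = (c - x) / (s - u)]].
have ub z v y : S z -> s < v -> (theta v <= y%:E)%E -> z <= (y - c) / (v - s).
  move=> [u [x [ug0 us ux ->]]] sv vy.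
  have := le_trans cs (theta_chord _ _ _ _ _ ug0 us sv ux vy).
  rewrite lee_fin ler_pdivlMr; last by lra.
  by rewrite ler_pdivrMr ?subr_gt0// mulrAC ler_pdivlMr ?subr_gt0//; lra.
have Su0 : S ((c - fine (theta u0)) / (s - u0)).
  by exists u0, (fine (theta u0)); rewrite -finite.
have supS : has_sup S.
  split; first by eexists; exact: Su0.
  exists ((fine (theta v0) - c) / (v0 - s)) => z Sz.
  by apply: ub => //; rewrite -finite.
exists (sup S) => u ug0; rewrite /line /=.
have := theta_proper.1 _ ug0; case E: (theta u) => [x| |] // _; last exact: leey.
have [us|su|us] := ltgtP u s.
- have Su : S ((c - x) / (s - u)) by exists u, x; rewrite E.
  have := sup_upper_bound supS Su.
  by rewrite ler_pdivrMr ?subr_gt0// lee_fin; lra.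
- have : sup S <= (x - c) / (u - s).
    apply: ge_sup; first by eexists; exact: Su0.
    by move=> z Sz; apply: ub; rewrite ?E.
  by rewrite ler_pdivlMr ?subr_gt0// lee_fin; lra.
- by rewrite us -E us; apply: le_trans cs; rewrite lee_fin; lra.
Qed.

(** If [theta] is finite at two points, their midpoint is interior to the effective domain. If it is
    finite at one point only, the constant line at that value works. *)
Lemma affine_minorant_exists : exists p, affine_minorant p.
Proof.
have [t0 t00 ft0] := theta_proper.2.
have [[t1 [t10 t1t0 ft1]]|single] :=
    pselect (exists t1, [/\ 0 <= t1, t1 != t0 & (theta t1 < +oo)%E]).
  suff interior (u v : R) : 0 <= u -> u < v ->
      (theta u < +oo)%E -> (theta v < +oo)%E -> exists p, affine_minorant p.
    have [lt01|lt10|eq01] := ltgtP t0 t1; last by rewrite eq01 eqxx in t1t0.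
      exact: (interior _ _ t00 lt01 ft0 ft1).
    exact: (interior _ _ t10 lt10 ft1 ft0).
  move=> u0 uv fu fv; pose s := (u + v) / 2.
  have us : u < s by rewrite /s; lra.
  have sv : s < v by rewrite /s; lra.
  have s0 : 0 <= s by lra.
  have [c cs] : exists c, (c%:E <= theta s)%E.
    have := theta_proper.1 _ s0; case: (theta s) => [x| |]// _; first by exists x.
    by exists 0; exact: leey.
  by have [b] := minorant_interior _ _ _ _ u0 us sv fu fv cs; exists (c - b * s, b).
exists (fine (theta t0), 0) => s s0; rewrite /line /= mul0r addr0.
have [->|st0] := eqVneq s t0.
  by have := theta_proper.1 _ t00; case: (theta t0) ft0.
rewrite leNgt; apply/negP => ltsM; apply: single; exists s; split => //.
exact: lt_trans ltsM (ltry _).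
Qed.

(* Where the effective domain lies on one side of [s], a steep enough line
   through [(s, c)] works: the cone [c - K |u - s|] is below [theta] near [s] by
   semicontinuity and elsewhere by comparison with any affine minorant. *)
Lemma minorant_touching s c : 0 <= s -> (c%:E < theta s)%E ->
  exists b, affine_minorant (c - b * s, b).
Proof.
move=> s0 cs; have [[a0 b0] minor0] := affine_minorant_exists.
have [e e0 near_s] := theta_lsc_ball _ _ s0 cs.
(* At distance at least [e] from [s], the first summand makes up for the gap at [s] between [c] and
   the affine minorant, and the second for the slope of that minorant. *)
pose K := `|a0 + b0 * s - c| / e + `|b0|.
have cone u : 0 <= u -> ((c - K * `|u - s|)%:E <= theta u)%E.
  move=> u0; have K0 : 0 <= K by rewrite addr_ge0 ?divr_ge0// ltW.
  have [ue|eu] := ltP `|u - s| e.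
    apply: le_trans (ltW (near_s _ u0 ue)); rewrite lee_fin.
    by rewrite lerBlDr lerDl mulr_ge0.
  apply: le_trans (minor0 _ u0); rewrite lee_fin /line /= /K mulrDl.
  have : `|a0 + b0 * s - c| <= `|a0 + b0 * s - c| / e * `|u - s|.
    by rewrite mulrAC ler_pdivlMr// ler_wpM2l.
  have := ler_norm (- (a0 + b0 * s - c)); rewrite normrN.
  have := ler_norm (- (b0 * (u - s))); rewrite normrN normrM.
  by lra.
have [[u [u0 us fu]]|left_empty] :=
    pselect (exists u, [/\ 0 <= u, u < s & (theta u < +oo)%E]); last first.
  exists (- K) => u u0; rewrite /line /=.
  have [su|us] := leP s u.
    apply: le_trans (cone _ u0); rewrite ger0_norm ?subr_ge0// lee_fin; lra.
  rewrite leNgt; apply/negP => ltM; apply: left_empty; exists u; split => //.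
  exact: lt_trans ltM (ltry _).
have [[v [sv fv]]|right_empty] :=
    pselect (exists v, s < v /\ (theta v < +oo)%E).
  exact: minorant_interior u0 us sv fu fv (ltW cs).
exists K => v v0; rewrite /line /=.
have [vs|sv] := leP v s.
  apply: le_trans (cone _ v0); rewrite distrC ger0_norm ?subr_ge0// lee_fin; lra.
rewrite leNgt; apply/negP => ltM; apply: right_empty; exists v; split => //.
exact: lt_trans ltM (ltry _).
Qed.

(** Past [t], convexity keeps [theta] above the line of slope [b] through [s]. On $[0,t]$ any affine
    minorant is a lower bound, so lowering the intercept far enough gives a global minorant of slope
    [b]. *)
Lemma minorant_of_secant s t b : 0 <= s -> s < t -> (theta s < +oo)%E ->
  ((fine (theta s) + b * (t - s))%:E <= theta t)%E ->
  exists a, affine_minorant (a, b).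
Proof.
move=> s0 st fs chord; have [[a0 b0] minor0] := affine_minorant_exists.
have fsE : theta s = (fine (theta s))%:E.
  by have := theta_proper.1 _ s0; case: (theta s) fs.
set x := fine (theta s) in chord fsE.
pose A := Num.min (x - b * s) (a0 - (`|b0| + `|b|) * t).
exists A => u u0; rewrite /line /=.
have [ut|tu] := leP u t.
  apply: le_trans (minor0 _ u0); rewrite lee_fin /line /=.
  have : A <= a0 - (`|b0| + `|b|) * t by rewrite /A ge_min lexx orbT.
  have := ler_norm (- b0); have := ler_norm b; rewrite normrN.
  by have := normr_ge0 b0; have := normr_ge0 b; nra.
have : ((x + b * (u - s))%:E <= theta u)%E.
  rewrite leNgt; apply/negP => /[dup] ltu.
  have fu : theta u = (fine (theta u))%:E.
    by have := theta_proper.1 _ u0; case: (theta u) ltu.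
  rewrite fu lte_fin => ltu'.
  have xs : (theta s <= x%:E)%E by rewrite fsE.
  have xu : (theta u <= (fine (theta u))%:E)%E by rewrite -fu.
  have := le_trans chord (theta_chord _ _ _ _ _ s0 st tu xs xu).
  rewrite lee_fin leNgt => /negP; apply.
  by rewrite ltr_pdivrMr; [nra|lra].
apply: le_trans; rewrite lee_fin.
have : A <= x - b * s by rewrite /A ge_min lexx.
lra.
Qed.

(** A minorant of slope above [c] forces $\theta(t)/t\ge c$ eventually. Conversely, if [b] exceeds
    the supremum, [theta] cannot rise above the line of slope [b] from a finite point, since
    [minorant_of_secant] would then give a minorant of slope [b]. *)
Lemma slope_infty_cvg : (theta t * (t^-1)%:E)%E @[t --> +oo%R] -->
  ereal_sup [set p.2%:E | p in affine_minorant].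
Proof.
set S := ereal_sup _.
have lower c : (c%:E < S)%E -> \forall t \near +oo%R, (c%:E <= theta t * (t^-1)%:E)%E.
  move=> /ereal_sup_gt[_ [[a b] minor <-]]; rewrite lte_fin /= => cb.
  near=> t.
  have t0 : 0 < t by near: t; apply: nbhs_pinfty_gt; exact: num_real.
  rewrite lee_pdivlMr//; apply: le_trans (minor _ (ltW t0)).
  rewrite -EFinM lee_fin /line /=.
  have : - a / (b - c) <= t by near: t; apply: nbhs_pinfty_ge; exact: num_real.
  by rewrite ler_pdivrMr ?subr_gt0//; lra.
have upper c : (S < c%:E)%E -> \forall t \near +oo%R, (theta t * (t^-1)%:E <= c%:E)%E.
  move=> Sc; have [s0 s00 fs0] := theta_proper.2.
  (* The strict gap between [b] and [c] absorbs, for large [t], the constant term of the line. *)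
  have [b Sb bc] : exists2 b, (S < b%:E)%E & b < c.
    move: Sc; case: (S) => [x| |]//= xc.
      by exists ((x + c) / 2); move: xc; rewrite ?lte_fin; lra.
    by exists (c - 1); rewrite ?ltNyr//; lra.
  have below t : s0 < t -> (theta t <= (fine (theta s0) + b * (t - s0))%:E)%E.
    move=> s0t; rewrite leNgt; apply/negP => /ltW.
    move=> /(minorant_of_secant _ _ _ s00 s0t fs0)[a minor].
    move: Sb; rewrite ltNge => /negP; apply.
    by apply: ereal_sup_ubound; exists (a, b).
  near=> t.
  have t0 : 0 < t by near: t; apply: nbhs_pinfty_gt; exact: num_real.
  rewrite lee_pdivrMr//; apply: (le_trans (below _ _)).
    by near: t; apply: nbhs_pinfty_gt; exact: num_real.
  rewrite -EFinM lee_fin.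
  have : (fine (theta s0) - b * s0) / (c - b) <= t.
    by near: t; apply: nbhs_pinfty_ge; exact: num_real.
  by rewrite ler_pdivrMr ?subr_gt0//; lra.
have [p minor] := affine_minorant_exists.
have pS : (p.2%:E <= S)%E by apply: ereal_sup_ubound; exists p.
case: (S) pS lower upper => [l| |]//= _ lower upper; last first.
  by apply/cvgeyPge => c; apply: lower; exact: ltry.
have near_l e : 0 < e -> \forall t \near +oo%R,
    ((l - e)%:E <= theta t * (t^-1)%:E)%E /\
    (theta t * (t^-1)%:E <= (l + e)%:E)%E.
  move=> e0; near=> t; split; near: t.
    by apply: lower; rewrite lte_fin; lra.
  by apply: upper; rewrite lte_fin; lra.
apply/fine_cvgP; split.
  by apply: filterS (near_l _ ltr01) => t; case: (_ * _)%E => [x| |]// [].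
apply/cvgrPdist_le => e e0; apply: filterS (near_l _ e0) => t /=.
case: (_ * _)%E => [x| |]//= []; rewrite ?lee_fin// => ? ?.
by rewrite ler_norml; lra.
Unshelve. all: by end_near. Qed.

(** Lowering both coefficients of a minorant keeps it a minorant on $[0,\infty)$, so rational
    coefficients suffice to approach all values and all slopes. Codes of no rational minorant are
    sent to the default [p0]. *)
Lemma minorant_sequence : exists L : nat -> R * R,
  [/\ forall n, affine_minorant (L n),
    forall s c, 0 <= s -> (c%:E < theta s)%E -> exists n, c < line (L n) s &
    forall p c, affine_minorant p -> c < p.2 -> exists n, c < (L n).2].
Proof.
have [p0 minor0] := affine_minorant_exists.
pose ratp (q : rat * rat) : R * R := (ratr q.1, ratr q.2).
pose L n := if unpickle n is Some q then
  if `[< affine_minorant (ratp q) >] then ratp q else p0 else p0.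
have rational p s c : affine_minorant p -> 0 <= s -> c < line p s ->
    exists n, [/\ c < line (L n) s & p.2 - 1 / (s + 1) * ((line p s - c) / 2) < (L n).2].
  (* The intercept drops by less than [e] and the slope by less than [e / (s + 1)]; together the
     value at [s] drops by less than [2 * e]. *)
  move=> minor s0 cp; pose e := (line p s - c) / 2.
  have e0 : 0 < e by rewrite /e; lra.
  have es : 0 < 1 / (s + 1) * e by rewrite mulr_gt0// divr_gt0//; lra.
  have [q1] := @rat_in_itvoo R (p.1 - e) p.1 ltac:(lra).
  rewrite in_itv /= => /andP[q1l q1u].
  have [q2] := @rat_in_itvoo R (p.2 - 1 / (s + 1) * e) p.2 ltac:(lra).
  rewrite in_itv /= => /andP[q2l q2u].
  have minorq : affine_minorant (ratp (q1, q2)).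
    move=> u u0; apply: le_trans (minor _ u0); rewrite lee_fin /line /=.
    by rewrite lerD ?ler_wpM2r// ltW.
  exists (pickle (q1, q2)); rewrite /L pickleK; case: asboolP => // _; split=> //.
  rewrite /line /=.
  have : (p.2 - 1 / (s + 1) * e) * s <= ratr q2 * s by rewrite ler_wpM2r// ltW.
  have : 1 / (s + 1) * e * s <= e.
    by rewrite mulrAC -[leRHS]mul1r ler_pM2r// mul1r mulrC ler_pdivrMr; lra.
  have : line p s - c = 2 * e by rewrite /e; lra.
  by rewrite /line; lra.
exists L; split.
- move=> n; rewrite /L; case: unpickle => // q; by case: asboolP.
- move=> s c s0 cs.
  have [c' cc' c's] : exists2 c', c < c' & (c'%:E < theta s)%E.
    have := theta_proper.1 _ s0; case: (theta s) cs => [x| |]// xc _.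
      by exists ((x + c) / 2); move: xc; rewrite ?lte_fin; lra.
    by exists (c + 1); rewrite ?ltry//; lra.
  have [b minor] := minorant_touching _ _ s0 c's.
  have [|n [cn _]] := rational _ _ c minor s0; last by exists n.
  by rewrite /line /=; lra.
- move=> p c minor cp.
  (* At the point 0 with gap [p.2 - c], the permitted drop in slope is half of that gap. *)
  have [|n [_ cn]] := rational _ 0 (line p 0 - (p.2 - c)) minor (lexx 0).
    by rewrite ltrBlDr ltrDl subr_gt0.
  by exists n; move: cn; rewrite add0r; lra.
Qed.

(** [phi n] is the maximum of the first [n.+1] lines of [minorant_sequence] and [m n] is their
    largest slope. Both are nondecreasing in [n], and their suprema are identified by the two
    density properties of the sequence. *)
Lemma hinge_sum_approximation : exists (phi : nat -> R -> R) (m : nat -> R),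
  [/\ forall n, hinge_sum (phi n) (m n),
    forall s, 0 <= s -> nondecreasing_seq (phi^~ s),
    nondecreasing_seq m,
    forall s, 0 <= s -> (phi n s)%:E @[n --> \oo] --> theta s &
    (m n)%:E @[n --> \oo] --> slope_infty theta].
Proof.
have [L [minor dense_val dense_slope]] := minorant_sequence.
have mkseq0 n : mkseq L n.+1 != [::] by rewrite -size_eq0 size_mkseq.
have /choice[phi] := fun n => hinge_sum_max_lines _ (mkseq0 n).
move=> /choice[m phiP]; exists phi, m.
have memL n k : (k <= n)%N -> L k \in mkseq L n.+1.
  by move=> kn; apply/mapP; exists k; rewrite ?mem_iota.
have exL n p : p \in mkseq L n.+1 -> exists2 k, (k <= n)%N & p = L k.
  by move=> /mapP[k]; rewrite mem_iota add0n => /andP[_ kn] ->; exists k.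
have phi_nd s : 0 <= s -> nondecreasing_seq (phi^~ s).
  move=> s0 n k nk; have [_ _ _ /(_ _ s0)[_ /exL[j jn ->] ->]] := phiP n.
  have [_ /(_ (L j)) ub _ _] := phiP k.
  by apply: (ub _).2 => //; apply: memL; exact: leq_trans nk.
have m_nd : nondecreasing_seq m.
  move=> n k nk; have [_ _ [_ /exL[j jn ->] ->] _] := phiP n.
  have [_ /(_ (L j)) ub _ _] := phiP k.
  by apply: (ub _).1; apply: memL; exact: leq_trans nk.
split => //; first by move=> n; have [] := phiP n.
- move=> s s0.
  rewrite (_ : theta s = ereal_sup (range (fun n => (phi n s)%:E))).
    by apply: ereal_nondecreasing_cvgn => n k nk; rewrite lee_fin phi_nd.
  apply/eqP; rewrite eq_le; apply/andP; split; last first.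
    apply: ge_ereal_sup => _ [n _ <-].
    by have [_ _ _ /(_ _ s0)[_ /exL[j jn ->] ->]] := phiP n; exact: minor.
  apply: lee_by_lower_reals => c cs; have [n cn] := dense_val _ _ s0 cs.
  apply: (@le_trans _ _ (phi n s)%:E).
    have [_ /(_ (L n)) ub _ _] := phiP n; rewrite lee_fin (le_trans (ltW cn))//.
    by apply: (ub _).2 => //; exact: memL.
  by apply: ereal_sup_ubound; exists n.
- rewrite /slope_infty (cvg_lim _ slope_infty_cvg)//.
  rewrite (_ : ereal_sup _ = ereal_sup (range (fun n => (m n)%:E))).
    by apply: ereal_nondecreasing_cvgn => n k nk; rewrite lee_fin m_nd.
  apply/eqP; rewrite eq_le; apply/andP; split; last first.
    apply: ge_ereal_sup => _ [n _ <-]; apply: ereal_sup_ubound.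
    by have [_ _ [_ /exL[j jn ->] ->] _] := phiP n; exists (L j).
  apply: ge_ereal_sup => _ [p pminor <-].
  apply: lee_by_lower_reals => c cp; have [n cn] := dense_slope _ _ pminor cp.
  apply: (@le_trans _ _ (m n)%:E).
    have [_ /(_ (L n)) ub _ _] := phiP n; rewrite lee_fin (le_trans (ltW cn))//.
    by apply: (ub _).1; exact: memL.
  by apply: ereal_sup_ubound; exists n.
Qed.

End AffineMinorants.

(** * Lebesgue decomposition *)

Section Measures.
Context {R : realType} {d : measure_display} {T : measurableType d}.
Implicit Types (P Q : {finite_measure set T -> \bar R}).
Local Open Scope ereal_scope.

Lemma finite_measure_of (mu : {measure set T -> \bar R}) : mu setT < +oo ->
  exists nu : {finite_measure set T -> \bar R}, nu = mu :> (set T -> \bar R).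
Proof.
move=> fin_mu; exists (mfrestr measurableT fin_mu).
by apply/funext => A; rewrite -[LHS]/(mu (A `&` setT)) setIT.
Qed.

Lemma weighted_measure (mu : {measure set T -> \bar R}) (f : T -> \bar R) :
  measurable_fun setT f -> (forall x, 0 <= f x) ->
  exists nu : {measure set T -> \bar R}, forall A, nu A = \int[mu]_(x in A) f x.
Proof.
move=> mf f0; pose nu0 A := \int[mu]_(x in A) f x.
have nu00 : nu0 set0 = 0 by rewrite /nu0 integral_set0.
have nu0_ge0 A : 0 <= nu0 A by exact: integral_ge0.
pose ax := isMeasure.Build d T R nu0 nu00 nu0_ge0
  (semi_sigma_additive_nng_induced mf f0).
by pose nu : Measure.type T R := HB.pack nu0 ax; exists nu.
Qed.

(** The given density [r] agrees [Q]-almost everywhere with the Radon-Nikodym derivative, for which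
    change of variables is available. *)
Lemma integral_density P Q (r f : T -> \bar R) (D : set T) :
  measurable_fun setT r -> (forall x, 0 <= r x) ->
  (forall A, measurable A -> P A = \int[Q]_(x in A) r x) ->
  measurable D -> measurable_fun D f -> (forall x, 0 <= f x) ->
  \int[P]_(x in D) f x = \int[Q]_(x in D) (f x * r x).
Proof.
move=> mr r0 PE mD mf f0.
have PQ : P `<< Q.
  apply/null_content_dominatesP => A mA QA.
  rewrite PE// null_set_integral//; exact: measurable_funTS.
rewrite -(Radon_Nikodym_SigmaFinite.change_of_variables PQ)//.
have [intg mg] : Q.-integrable setT (Radon_Nikodym_SigmaFinite.f P Q) /\
    measurable_fun setT (Radon_Nikodym_SigmaFinite.f P Q).
  split; last apply: measurable_int; exact: Radon_Nikodym_SigmaFinite.f_integrable.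
apply: ae_eq_integral => //.
- by apply: emeasurable_funM => //; exact: measurable_funTS.
- by apply: emeasurable_funM => //; exact: measurable_funTS.
apply: ae_eqe_mul2l; apply: integral_ae_eq => //.
- exact: (integrableS measurableT).
- exact: measurable_funTS.
- move=> A AD mA.
  by rewrite -Radon_Nikodym_SigmaFinite.f_integral// PE.
Qed.

(** With $\mu=P+Q$ and $f=dQ/d\mu$, the set $N=\{f=0\}$ is [Q]-null, and [P] restricted to it is the
    singular part. Off [N] the density [f] is positive, so [Q]-null sets are $\mu$-null there and
    [P] has a density with respect to [Q]. *)
Lemma lebesgue_decomposition_exists P Q : exists r (Pperp : {measure set T -> \bar R}),
  lebesgue_decomposition P Q r Pperp.
Proof.
have [mu muE] : exists mu : {finite_measure set T -> \bar R},
    forall A, mu A = P A + Q A.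
  have [|mu muE] := finite_measure_of (measure_add P Q).
    rewrite (_ : _ setT = P setT + Q setT); last exact: measure_addE.
    by rewrite lte_add_pinfty// ltey_eq fin_num_measure.
  by exists mu => A; rewrite muE; exact: measure_addE.
have [|f [f0 ffin intf fE]] := @radon_nikodym_sigma_finite _ _ _ mu Q.
  apply/null_content_dominatesP => A mA muA0; have : mu A = 0 by [].
  move/eqP; rewrite muE.
  by rewrite padde_eq0// => /andP[_ /eqP].
have mf : measurable_fun setT f by exact: measurable_int intf.
pose N := [set x | f x = 0].
have mN : measurable N.
  have := mf measurableT _ (emeasurable_set1 0); rewrite setTI.
  by congr measurable; apply/seteqP; split.
have QN : Q N = 0.
  by rewrite fE//; apply: integral0_eq.
have mNC : measurable (~` N) by exact: measurableC.
have [|r [r0 rfin intr rE]] := @radon_nikodym_sigma_finite _ _ _ Q (mrestr P mNC).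
  apply/null_content_dominatesP => A mA QA.
  have mAN : measurable (A `&` ~` N) by exact: measurableI.
  suff : mu (A `&` ~` N) = 0.
    by rewrite muE => /eqP; rewrite padde_eq0// => /andP[/eqP + _].
  have : \int[mu]_(x in A `&` ~` N) `|f x| = 0.
    under eq_integral do rewrite gee0_abs//.
    by rewrite -fE//; apply/eqP; rewrite -measure_le0 -QA le_measure ?inE.
  move=> /(ae_eq_integral_abs mu mAN (measurable_funTS mf))[M [mM M0 sM]].
  apply: (subset_measure0 mAN mM _ M0) => x ANx; apply: sM => /= /(_ ANx).
  exact: ANx.2.
exists (fine \o r), (mrestr P mN); split.
- apply: measurableT_comp => //; exact: measurable_int intr.
- by move=> x; rewrite fine_ge0.
- exists N; split => //; rewrite -[LHS]/(P (~` N `&` N)) setICl.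
  exact: measure0.
- move=> A mA; under eq_integral do rewrite /= fineK//.
  by rewrite -rE// (measureDI P mA mN) setDE.
Qed.

End Measures.

(** * Comparison of divergences *)

Section IntegralAboveIntegrable.
Context {R : realType} {d : measure_display} {T : measurableType d}.
Variable mu : {measure set T -> \bar R}.
Local Open Scope ereal_scope.

(** Additivity persists when [f] is not integrable: if the integral of $f-g$ is infinite, so is that
    of $f^+$, while $f^-\le g^-$ has finite integral. This reduces functions with an integrable
    lower bound to nonnegative ones. *)
Lemma integral_above_integrable (f : T -> \bar R) (g : T -> R) :
  measurable_fun setT f -> mu.-integrable setT (EFin \o g) ->
  (forall x, (g x)%:E <= f x) ->
  \int[mu]_x f x = \int[mu]_x (f x - (g x)%:E) + \int[mu]_x (g x)%:E.
Proof.
move=> mf ig gf; have mg : measurable_fun setT (EFin \o g) by exact: measurable_int ig.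
have mfg : measurable_fun setT (fun x => f x - (g x)%:E).
  exact: emeasurable_funB.
have fg0 x : 0 <= f x - (g x)%:E by rewrite sube_ge0.
have gfin : \int[mu]_x (g x)%:E \is a fin_num by exact: integrable_fin_num.
have [fgoo|fgfin] := eqVneq (\int[mu]_x (f x - (g x)%:E)) +oo.
  have fposoo : \int[mu]_x f^\+ x = +oo.
    apply: contra_eq fgoo; rewrite -ltey => fpos.
    rewrite -ltey; apply: (@le_lt_trans _ _ (\int[mu]_x (f^\+ x + (EFin \o g)^\- x))).
      apply: ge0_le_integral => //.
      - by apply: emeasurable_funD; [exact: measurable_funepos|exact: measurable_funeneg].
      - move=> x _; apply: leeD; first by rewrite funeposE le_max lexx.
        by rewrite funenegE /= le_max lexx.
    rewrite ge0_integralD//; last 2 first.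
    - exact: measurable_funepos.
    - exact: measurable_funeneg.
    by rewrite lte_add_pinfty//; exact: integral_funeneg_lt_pinfty.
  have fneg : \int[mu]_x f^\- x < +oo.
    apply: (le_lt_trans _ (integral_funeneg_lt_pinfty measurableT ig)).
    apply: ge0_le_integral => //; try exact: measurable_funeneg.
    by move=> x _; rewrite !funenegE ge_max !le_max lexx orbT andbT leeN2 gf.
  rewrite fgoo integralE fposoo; move: gfin fneg.
  have := integral_ge0 mu (f := f^\-) (D := setT) (fun x _ => funeneg_ge0 f x).
  by case: (integral mu _ f^\-) => [x| |]//; case: (\int[mu]_x (g x)%:E).
have ifg : mu.-integrable setT (fun x => f x - (g x)%:E).
  apply/integrableP; split => //; under eq_integral do rewrite gee0_abs//.
  by rewrite ltey.
rewrite -integralD//; apply: eq_integral => x _.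
by rewrite subeK.
Qed.

End IntegralAboveIntegrable.

Section Comparison.
Context {R : realType} {d : measure_display} {T : measurableType d}.
Variable Q : {finite_measure set T -> \bar R}.
Implicit Types (phi : R -> R) (m : R) (r : T -> R).

Lemma integrable_min r (t : R) : (forall x, 0 <= r x) -> 0 <= t ->
  Q.-integrable setT (EFin \o r) ->
  Q.-integrable setT (EFin \o (fun x => Num.min (r x) t)).
Proof.
move=> r0 t0 ir; apply: (le_integrable measurableT _ _ ir).
  apply/measurable_EFinP; apply: measurable_minr => //.
  by apply/measurable_EFinP; exact: measurable_int ir.
move=> x _ /=; rewrite lee_fin !ger0_norm// ?ge_min ?lexx//.
by rewrite le_min r0.
Qed.

Lemma hinge_sum_integrable phi m r :
  hinge_sum phi m -> (forall x, 0 <= r x) -> Q.-integrable setT (EFin \o r) ->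
  Q.-integrable setT (EFin \o (phi \o r)).
Proof.
move=> H r0 ir.
have icst c : Q.-integrable setT (EFin \o cst c).
  exact: finite_measure_integrable_cst.
elim: H => {phi m} [a b|phi m c t c0 t0 _ IH|phi psi m E _ IH].
- exact: (integrableD measurableT (icst a) (integrableZl measurableT b ir)).
- have ih := integrableB measurableT ir (integrable_min _ _ r0 t0 ir).
  exact: (integrableD measurableT IH (integrableZl measurableT c ih)).
- apply: eq_integrable IH => // x _ /=; by rewrite E.
Qed.

Variables (r1 r2 : T -> R) (p1 p2 : R).
Hypotheses (r1_ge0 : forall x, 0 <= r1 x) (r2_ge0 : forall x, 0 <= r2 x)
  (p1_ge0 : 0 <= p1) (p2_ge0 : 0 <= p2)
  (ir1 : Q.-integrable setT (EFin \o r1)) (ir2 : Q.-integrable setT (EFin \o r2))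
  (mass : \int[Q]_x r1 x + p1 = \int[Q]_x r2 x + p2)
  (level : forall t, 0 < t ->
    \int[Q]_x Num.min (r2 x) t <= \int[Q]_x Num.min (r1 x) t).

(** Here [r1], [p1] are the density and singular mass of the optimal payload, and [r2], [p2] those
    of a competitor. Affine parts agree by equality of masses. A hinge of weight [c] contributes [c]
    times the total mass minus the integral of [Num.min r t], so [level] gives the inequality. *)
Lemma hinge_sum_comparison phi m : hinge_sum phi m ->
  \int[Q]_x phi (r1 x) + m * p1 <= \int[Q]_x phi (r2 x) + m * p2.
Proof.
have icst c : Q.-integrable setT (EFin \o cst c).
  exact: finite_measure_integrable_cst.
elim=> {phi m} [a b|phi m c t c0 t0 H IH|phi psi m E H IH].
- have int r : Q.-integrable setT (EFin \o r) ->
      \int[Q]_x (a + b * r x) = \int[Q]_x (cst a x) + b * \int[Q]_x r x.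
    move=> ir; rewrite RintegralD//; first by rewrite RintegralZl.
      exact: icst.
    exact: (integrableZl measurableT b ir).
  by rewrite !int// -!addrA lerD2l -!mulrDr mass.
- have int r : (forall x, 0 <= r x) -> Q.-integrable setT (EFin \o r) ->
      \int[Q]_x (phi (r x) + c * (r x - Num.min (r x) t)) =
      \int[Q]_x phi (r x) + c * (\int[Q]_x r x - \int[Q]_x Num.min (r x) t).
    move=> r0 ir; have imr := integrable_min _ _ r0 t0 ir.
    have ih : Q.-integrable setT (EFin \o (fun x => r x - Num.min (r x) t)).
      exact: (integrableB measurableT ir imr).
    rewrite RintegralD//; first by rewrite RintegralZl// RintegralB.
      exact: (hinge_sum_integrable _ _ _ H).
    exact: (integrableZl measurableT c ih).
  rewrite !int//.
  (* [level] covers positive [t]; at [t = 0] both integrands vanish. *)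
  have lev : \int[Q]_x Num.min (r2 x) t <= \int[Q]_x Num.min (r1 x) t.
    move: t0; rewrite le_eqVlt => /orP[/eqP <-|/level//].
    by under eq_Rintegral do rewrite min_r//; under [leRHS]eq_Rintegral do rewrite min_r//.
  have := ler_wpM2l c0 lev; have : c * (\int[Q]_x r1 x + p1) = c * (\int[Q]_x r2 x + p2).
    by rewrite mass.
  by move: IH; lra.
- have EI r : (forall x, 0 <= r x) -> \int[Q]_x psi (r x) = \int[Q]_x phi (r x).
    by move=> r0; apply: eq_Rintegral => x _; rewrite E.
  by rewrite !EI.
Qed.

Lemma divergence_comparison (theta : R -> \bar R) :
  nnproper theta -> nnconvex theta -> nnlsc theta ->
  (\int[Q]_x theta (r1 x) + slope_infty theta * p1%:E <=
   \int[Q]_x theta (r2 x) + slope_infty theta * p2%:E)%E.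
Proof.
move=> prop conv lsc.
have [phi [m [H phi_nd m_nd phi_cvg m_cvg]]] := hinge_sum_approximation _ prop conv lsc.
have iphi n r : (forall x, 0 <= r x) -> Q.-integrable setT (EFin \o r) ->
    Q.-integrable setT (EFin \o (phi n \o r)).
  exact: hinge_sum_integrable (H n).
have mphi n r : (forall x, 0 <= r x) -> Q.-integrable setT (EFin \o r) ->
    measurable_fun setT (fun x => (phi n (r x))%:E).
  by move=> r0 ir; exact: measurable_int (iphi n r r0 ir).
have mtheta r : (forall x, 0 <= r x) -> Q.-integrable setT (EFin \o r) ->
    measurable_fun setT (theta \o r).
  move=> r0 ir; apply: (emeasurable_fun_cvg (fun n x => (phi n (r x))%:E)).
    by move=> n; exact: mphi.
  by move=> x _; exact: phi_cvg.
have phi_le n s : 0 <= s -> ((phi n s)%:E <= theta s)%E.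
  move=> s0; rewrite -(cvg_lim _ (phi_cvg _ s0))//.
  apply: lime_ge; first by apply/cvg_ex; eexists; exact: phi_cvg.
  by exists n => // k /= nk; rewrite lee_fin; exact: phi_nd.
have m_le n : ((m n)%:E <= slope_infty theta)%E.
  rewrite -(cvg_lim _ m_cvg)//.
  apply: lime_ge; first by apply/cvg_ex; eexists; exact: m_cvg.
  by exists n => // k /= nk; rewrite lee_fin; exact: m_nd.
(* The competitor side is bounded by its full divergence at once, so a limit is taken on the side of
   [r1] only. *)
have above n : (\int[Q]_x (phi n (r1 x))%:E + (m n * p1)%:E <=
    \int[Q]_x theta (r2 x) + slope_infty theta * p2%:E)%E.
  apply: (@le_trans _ _ (\int[Q]_x (phi n (r2 x))%:E + (m n * p2)%:E)%E).
    have := hinge_sum_comparison _ _ (H n); rewrite -lee_fin !EFinD.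
    by rewrite /Rintegral !fineK//; apply: integrable_fin_num => //; exact: iphi.
  apply: leeD; last by rewrite EFinM lee_wpmul2r.
  rewrite [leRHS](integral_above_integrable _ _ _ _ (iphi n _ r2_ge0 ir2)).
  - by rewrite leeDr// integral_ge0// => x _; rewrite sube_ge0//; exact: phi_le.
  - exact: (mtheta r2).
  - by move=> x; exact: phi_le.
(* Subtracting the integrable function [phi 0 \o r1] makes the increasing sequence nonnegative, as
   monotone convergence requires. *)
have cvg_int : (\int[Q]_x (phi n (r1 x))%:E)%E @[n --> \oo] -->
    (\int[Q]_x theta (r1 x))%E.
  rewrite [X in _ --> X](integral_above_integrable _ _ _ _ (iphi 0%N _ r1_ge0 ir1)); last 2 first.
  - exact: (mtheta r1).
  - by move=> x; exact: phi_le.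
  rewrite (_ : (fun n => _) = (fun n => \int[Q]_x ((phi n (r1 x))%:E - (phi 0%N (r1 x))%:E) +
      \int[Q]_x (phi 0%N (r1 x))%:E)%E); last first.
    apply/funext => n; apply: integral_above_integrable.
    - exact: mphi.
    - exact: iphi.
    - by move=> x; rewrite lee_fin; exact: phi_nd.
  apply: cvgeD; last exact: cvg_cst.
    by rewrite fin_num_adde_defl//; apply: integrable_fin_num => //; exact: iphi.
  rewrite (_ : (fun x => _) = (fun x => limn (fun n => (phi n (r1 x))%:E - (phi 0%N (r1 x))%:E)%E)).
    apply: cvg_monotone_convergence => //.
    - by move=> n; apply: emeasurable_funB; exact: mphi.
    - by move=> n x _; rewrite sube_ge0// lee_fin; exact: phi_nd.
    - by move=> x _ n k nk; rewrite leeD2r// lee_fin; exact: phi_nd.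
  apply/funext => x; apply/esym/cvg_lim => //; apply: cvgeB; last exact: cvg_cst.
    exact: fin_num_adde_defl.
  exact: phi_cvg.
have cvg_slope : (m n * p1)%:E @[n --> \oo] --> (slope_infty theta * p1%:E)%E.
  under eq_fun do rewrite EFinM.
  exact: cvgeZr.
(* Both summands are bounded below by their finite counterparts at index 0, so neither is [-oo] and
   limits may be added. *)
have sum_def : (\int[Q]_x theta (r1 x) +? slope_infty theta * p1%:E)%E.
  apply: ltninfty_adde_def; rewrite inE.
    apply: (@lt_le_trans _ _ (\int[Q]_x (phi 0%N (r1 x))%:E)%E).
      by rewrite ltNye_eq (integrable_fin_num measurableT (iphi 0%N _ r1_ge0 ir1)).
    rewrite [leRHS](integral_above_integrable _ _ _ _ (iphi 0%N _ r1_ge0 ir1)).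
    - by rewrite leeDr// integral_ge0// => x _; rewrite sube_ge0//; exact: phi_le.
    - exact: (mtheta r1).
    - by move=> x; exact: phi_le.
  apply: (@lt_le_trans _ _ (m 0%N * p1)%:E); first exact: ltNyr.
  by rewrite EFinM lee_wpmul2r.
rewrite -(cvg_lim _ (cvgeD sum_def cvg_int cvg_slope))//.
apply: lime_le; first by apply/cvg_ex; eexists; exact: (cvgeD sum_def cvg_int cvg_slope).
by apply: nearW.
Qed.

End Comparison.

(** * Open subsets of a product of Polish spaces *)

Section CountableBasis.
Context {R : realType}.

(** The basis consists of the balls of radius $1/(j+1)$ around the points of a countable dense
    set. *)
Lemma polish_countable_basis (X : ptopologicalType) : polish R X ->
  exists B : nat -> set X, (forall n, open (B n)) /\
    forall x A, nbhs x A -> exists2 n, B n x & B n `<=` A.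
Proof.
move=> [[D /countable_injP[f f_inj] D_dense]
  [dist [dist0 distC dist_triangle dist_nbhs _]]].
pose ball_ x e := [set y | dist x y < e].
have ball_open x e : open (ball_ x e).
  rewrite openE => y xy; apply/dist_nbhs; exists (e - dist x y).
    by rewrite subr_gt0.
  by move=> z /= yz; apply: le_lt_trans (dist_triangle _ y _) _; lra.
(* This inverts the injection [f] on its image; other indices give some harmless ball. *)
pose center k := get [set d | D d /\ f d = k].
pose B n := if (unpickle n : option (nat * nat)) is Some (k, j) then
  ball_ (center k) j.+1%:R^-1 else set0.
exists B; split=> [n|x A /dist_nbhs[e e0 eA]].
  by rewrite /B; case: unpickle => [[k j]|]; [exact: ball_open|exact: open0].
(* The factor 2 is the diameter bound: a ball of this radius that contains [x] lies within distance
   [e] of [x]. *)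
have [j je] : exists j : nat, 2 * j.+1%:R^-1 < e.
  exists (Num.truncn (2 / e)).
  by rewrite ltr_pdivrMr// mulrC -ltr_pdivrMr// truncnS_gt.
have [||d [xd Dd]] := D_dense (ball_ x j.+1%:R^-1).
- by exists x; rewrite /ball_ /= (dist0 x x).2// invr_gt0.
- exact: ball_open.
have centerE : center (f d) = d.
  have [Dc fc] : [set d' | D d' /\ f d' = f d] (center (f d)).
    by apply: getPex; exists d.
  by apply: f_inj; rewrite ?inE.
exists (pickle (f d, j)); rewrite /B pickleK centerE /ball_ /=; first by rewrite distC.
move=> y /= dy; apply: eA => /=.
apply: le_lt_trans (dist_triangle _ d _) _.
by move: xd dy je; rewrite /ball_ /=; set q := _^-1; move: q => q; lra.
Qed.

(** [U] is the countable union of the basic open rectangles it contains. *)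
Lemma open_measurable_prod (X Y : ptopologicalType) (U : set (X * Y)) :
  polish R X -> polish R Y -> open U ->
  measurable (U : set (borel X * borel Y)).
Proof.
move=> /polish_countable_basis[B [Bo Bbasis]] /polish_countable_basis[C [Co Cbasis]].
rewrite openE => Uo; pose V i j := if `[< B i `*` C j `<=` U >] then B i `*` C j else set0.
have -> : U = \bigcup_i \bigcup_j V i j.
  apply/seteqP; split=> [[x y] Uxy|xy [i _ [j _]]]; last first.
    by rewrite /V; case: asboolP => // BCU /BCU.
  have [[P Q] [/= xP yQ] PQU] := Uo _ Uxy.
  have [i Bx BP] := Bbasis _ _ xP; have [j Cy CQ] := Cbasis _ _ yQ.
  exists i => //; exists j => //; rewrite /V; case: asboolP => //.
  by case=> -[u v] [/= Bu Cv]; apply: PQU; split; [exact: BP|exact: CQ].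
apply: bigcup_measurable => i _; apply: bigcup_measurable => j _.
rewrite /V; case: asboolP => // _.
by apply: measurableX; apply: sub_sigma_algebra; [exact: Bo|exact: Co].
Qed.

End CountableBasis.

(** * Payloads of refinements *)

Section Payloads.
Context {R : realType} {X : bool -> ptopologicalType}.
Local Open Scope ereal_scope.

Lemma measurable_pr i : measurable_fun setT (@pr X i).
Proof. by case: i; [exact: measurable_snd|exact: measurable_fst]. Qed.

Lemma measurable_pr_preimage i (A : set (borel (X i))) :
  measurable A -> measurable (@pr X i @^-1` A).
Proof. by move=> mA; rewrite -[_ @^-1` _]setTI; exact: measurable_pr. Qed.

Lemma payload_measure i (pi : plan) : exists P : {finite_measure set borel (X i) -> \bar R},
  P = payload i pi :> (set (borel (X i)) -> \bar R).
Proof.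
have [mu muE] : exists mu : {measure set borel (X i) -> \bar R},
    mu = payload i pi :> (set (borel (X i)) -> \bar R).
  by unshelve eexists (pushforward pi (@pr X i)); first exact: measurable_pr.
have [|P PE] := finite_measure_of mu; last by exists P; rewrite PE.
rewrite muE.
by rewrite -[X in X < _]/(pi setT) ltey_eq fin_num_measure.
Qed.

Lemma integral_payload i (pi : @plan R X) (P : {measure set borel (X i) -> \bar R})
    (B : set (borel (X i))) (f : borel (X i) -> \bar R) :
  P = payload i pi :> (set (borel (X i)) -> \bar R) ->
  measurable B -> measurable_fun setT f -> (forall y, 0 <= f y) ->
  \int[pi]_(z in @pr X i @^-1` B) f (pr i z) = \int[P]_(y in B) f y.
Proof.
move=> PE mB mf f0; rewrite -(ge0_integral_pushforward (measurable_pr i) pi mB); last 2 first.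
- exact: measurable_funTS.
- by move=> y _.
apply: eq_measure_integral => [|mpr A mA _]; first exact: measurable_pr.
exact: (congr1 (@^~ A) (esym PE)).
Qed.

(** Existence of a decomposition guarantees that the pair picked by [get] is one. *)
Lemma payload_decomposition i (pi : @plan R X) (Q : {finite_measure set borel (X i) -> \bar R}) :
  exists2 Pperp : {measure set borel (X i) -> \bar R},
    singular_part (payload i pi) Q = Pperp :> (set (borel (X i)) -> \bar R) &
    lebesgue_decomposition (payload i pi) Q (density (payload i pi) Q) Pperp.
Proof.
have [P PE] := payload_measure i pi.
have [r [Pperp dec]] := lebesgue_decomposition_exists P Q.
rewrite /singular_part /density /lebesgue_pair.
set S := (S in get S); suff : S (get S) by [].
by apply: getPex; exists (r, Pperp : set (borel (X i)) -> \bar R); exists Pperp; rewrite // -PE.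
Qed.

Variables (E : set (X false * X true)).
Variable nu : forall i : bool, {finite_measure set borel (X i) -> \bar R}.

Lemma capped_density_le_fit i (pi : @plan R X) (t : R) :
  measurable (~` E : set (borel (X false) * borel (X true))) ->
  refinement E nu i pi -> (0 < t)%R ->
  \int[nu (~~ i)]_y (Num.min (density (payload (~~ i) pi) (nu (~~ i)) y) t)%:E <=
  fit E nu i t.
Proof.
move=> mE [piE pinu] t0; set Q := nu (~~ i).
have [Pperp _ [mr r0 [N [mN QN PN]] PE]] := payload_decomposition (~~ i) pi Q.
set r := density _ _ in mr r0 PE *.
have [P Ppi] := payload_measure (~~ i) pi.
have max0 y : (0 < Num.max (r y) t)%R by rewrite lt_max t0 orbT.
(* The indicator discards the mass over the [Q]-null set [N] that carries [Pperp]; off [N], [w * r]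
   equals [Num.min r t]. *)
pose w y : R := (\1_(~` N) y * (t / Num.max (r y) t))%R.
have w0 y : (0 <= w y)%R.
  by rewrite /w mulr_ge0// divr_ge0// ltW.
have w1 y : (w y <= 1)%R.
  rewrite /w indicE; case: (_ \in _); rewrite ?mul0r ?mul1r ?ler01//.
  by rewrite ler_pdivrMr// mul1r le_max lexx orbT.
have mw : measurable_fun setT w.
  apply: measurable_funM.
    by apply: measurable_indic; exact: measurableC.
  apply: (@measurableT_comp _ _ _ _ _ _ (fun x : R => t / Num.max x t)%R) => //.
  apply: continuous_measurable_fun => x; apply: cvgM; first exact: cvg_cst.
  apply: cvgV; first by rewrite gt_eqF// lt_max t0 orbT.
  by apply: continuous_max; [exact: cvg_id|exact: cvg_cst].
have mwpr : measurable_fun setT (fun z => (w (pr (~~ i) z))%:E).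
  by apply/measurable_EFinP; apply: measurableT_comp => //; exact: measurable_pr.
have [sigma0 sigma0E] := weighted_measure pi _ mwpr (fun z => w0 (pr (~~ i) z)).
have sigma0_le A : measurable A -> sigma0 A <= pi A.
  move=> mA; rewrite sigma0E -[leRHS]mul1e -integral_cst//.
  apply: ge0_le_integral => //.
  - by move=> z _; rewrite lee_fin.
  - exact: measurable_funTS.
  - by move=> z _; rewrite lee_fin.
have [|sigma sigmaE'] := finite_measure_of sigma0.
  by rewrite (le_lt_trans (sigma0_le _ _))// ltey_eq fin_num_measure.
have sigmaE A : sigma A = \int[pi]_(z in A) (w (pr (~~ i) z))%:E.
  by rewrite sigmaE' sigma0E.
have sigma_le A : measurable A -> sigma A <= pi A.
  by rewrite sigmaE'; exact: sigma0_le.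
have mwr : measurable_fun setT (fun y => (w y * r y)%:E).
  by apply/measurable_EFinP; exact: measurable_funM.
have sigma_payload B : measurable B ->
    payload (~~ i) sigma B = \int[Q]_(y in B) (w y * r y)%:E.
  move=> mB; rewrite -[LHS]/(sigma (@pr X (~~ i) @^-1` B)) sigmaE.
  have mwE : measurable_fun setT (fun y => (w y)%:E) by exact/measurable_EFinP.
  have mrE : measurable_fun setT (fun y => (r y)%:E) by exact/measurable_EFinP.
  rewrite (integral_payload _ _ P _ (fun y => (w y)%:E))//.
  have [Pr0 Pr0E] := weighted_measure Q _ mrE r0.
  have Pfin : P setT < +oo by rewrite ltey_eq fin_num_measure.
  have PdecE A : measurable A -> P A = Pr0 A + Pperp A.
    by move=> mA; rewrite Ppi PE// Pr0E.
  have [|Pr PrE] := finite_measure_of Pr0.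
    by rewrite (le_lt_trans _ Pfin)// PdecE// leeDl.
  (* The payload is split into its absolutely continuous part [Pr] and [Pperp]; the latter
     contributes 0 because [w] vanishes on [N]. *)
  transitivity (\int[measure_add Pr Pperp]_(y in B) (w y)%:E).
    apply: eq_measure_integral => A mA _.
    rewrite [RHS](_ : _ = Pr A + Pperp A); last exact: measure_addE.
    by rewrite PrE -PdecE.
  rewrite ge0_integral_measure_add//; last 2 first.
  - by move=> y _; rewrite lee_fin.
  - exact: measurable_funTS.
  rewrite [X in _ + X](_ : _ = 0) ?adde0; last first.
    rewrite (ge0_ae_eq_integral (g := cst 0))// ?integral0//.
    - exact: measurable_funTS.
    - by move=> y _; rewrite lee_fin.
    - exists (~` N); split => //; first exact: measurableC.
      apply: subsetC => y Ny _; by rewrite /w indicE memNset//= mul0r.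
  rewrite (integral_density Pr Q (EFin \o r))//.
  - by move=> A mA; rewrite PrE Pr0E.
  - exact: measurable_funTS.
have capped y : ~ N y -> (w y * r y = Num.min (r y) t)%R.
  move=> Ny; rewrite /w indicE mem_set//= mul1r mulrAC.
  apply: (mulIf (lt0r_neq0 (max0 y))); rewrite mulfVK ?gt_eqF//.
  by case: (leP (r y) t) => _; rewrite mulrC.
have capped_le y : (w y * r y <= t)%R.
  have [Ny|/capped->] := pselect (N y); last by rewrite ge_min lexx orbT.
  by rewrite /w indicE memNset ?mul0r ?ltW//= => /(_ Ny).
apply: (@le_trans _ _ (sigma setT)).
  rewrite -[sigma setT]/(payload (~~ i) sigma setT) sigma_payload//.
  rewrite (ge0_ae_eq_integral (g := fun y => (w y * r y)%:E))//.
  - by apply/measurable_EFinP; exact: measurable_minr.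
  - by move=> y _; rewrite lee_fin le_min r0 ltW.
  - by move=> y _; rewrite lee_fin mulr_ge0.
  - exists N; split => //.
    by rewrite -[X in _ `<=` X]setCK; apply: subsetC => y Ny _; rewrite capped.
(* Support in [E] and the bound on side [i] follow from [sigma <= pi]; the bound on the opposite
   side follows from [w * r <= t]. *)
apply: ereal_sup_ubound; exists sigma => //; split.
- by apply/eqP; rewrite -measure_le0 -[leRHS]piE sigma_le.
- move=> A mA; rewrite -pinu//; apply: sigma_le; exact: measurable_pr_preimage.
- move=> B mB; rewrite sigma_payload// -integral_cst//.
  apply: ge0_le_integral => //.
  - by move=> y _; rewrite lee_fin mulr_ge0.
  - exact: measurable_funTS.
  - by move=> y _; rewrite lee_fin.
Qed.

Lemma refinement_mass i (pi : @plan R X) : refinement E nu i pi ->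
  let Q := nu (~~ i) in let r := density (payload (~~ i) pi) Q in
  exists p : R, [/\ (forall y, 0 <= r y)%R, (0 <= p)%R,
    Q.-integrable setT (EFin \o r), singular_part (payload (~~ i) pi) Q setT = p%:E &
    (\int[Q]_y r y + p)%R = fine (nu i setT)].
Proof.
move=> [_ pinu] Q r.
have [Pperp PperpE [mr r0 _ PE]] := payload_decomposition (~~ i) pi Q.
have mrE : measurable_fun setT (EFin \o r) by exact/measurable_EFinP.
(* Both payloads of [pi] have total mass [pi setT], since the preimage of the whole space under
   either projection is the whole product. *)
have total : nu i setT = \int[Q]_y (r y)%:E + Pperp setT by rewrite -pinu// -PE.
have int0 : 0 <= \int[Q]_y (r y)%:E by apply: integral_ge0 => y _; rewrite lee_fin.
have nu_fin : nu i setT \is a fin_num by exact: fin_num_measure.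
have : \int[Q]_y (r y)%:E + Pperp setT \is a fin_num by rewrite -total.
rewrite fin_numD => /andP[int_fin perp_fin].
exists (fine (Pperp setT)); split => //.
- apply/integrableP; split => //; under eq_integral do rewrite /= ger0_norm//.
  by rewrite ltey_eq int_fin.
- by rewrite PperpE fineK.
- by rewrite total fineD.
Qed.

End Payloads.

Local Open Scope ereal_scope.

Theorem theorem6p3 (R : realType) (X : bool -> ptopologicalType)
    (polishX : forall i : bool, polish R (X i))
    (E : set (X false * X true)) (closedE : closed E)
    (N1_neq0 : forall x : X false, N1 E x !=set0)
    (N0_neq0 : forall y : X true, N0 E y !=set0)
    (nu : forall i : bool, {finite_measure set borel (X i) -> \bar R})
    (nu_neq0 : forall i : bool, nu i setT != 0)
    (iota : bool)
    (theta : R -> \bar R) (theta_proper : nnproper theta)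
    (theta_convex : nnconvex theta) (theta_lsc : nnlsc theta)
    (pistar : plan) (pistar_refinement : refinement E nu iota pistar)
    (pistar_level_optimal : level_optimal E nu iota pistar) :
  divergence theta (payload (~~ iota) pistar) (nu (~~ iota)) =
  ereal_inf [set divergence theta (payload (~~ iota) pi) (nu (~~ iota))
            | pi in refinement E nu iota].
Proof.
have mE : measurable (~` E : set (borel (X false) * borel (X true))).
  by apply: open_measurable_prod (polishX false) (polishX true) _; exact: closed_openC.
apply/eqP; rewrite eq_le; apply/andP; split; last first.
  by apply: ereal_inf_lbound; exists pistar.
apply: le_ereal_inf_tmp => _ [pi pi_refinement <-].
have [p1 [r1_ge0 p1_ge0 ir1 p1E mass1]] := refinement_mass _ _ _ _ pistar_refinement.
have [p2 [r2_ge0 p2_ge0 ir2 p2E mass2]] := refinement_mass _ _ _ _ pi_refinement.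
rewrite /divergence p1E p2E.
apply: divergence_comparison => //; first by rewrite mass1 mass2.
move=> t t0; apply: fine_le.
- by apply: integrable_fin_num => //; apply: integrable_min => //; exact: ltW.
- by apply: integrable_fin_num => //; apply: integrable_min => //; exact: ltW.
(* The fit at level [t] is attained by [pistar] and bounds the capped integral of every
   competitor. *)
- by rewrite pistar_level_optimal//; exact: capped_density_le_fit.
Qed.
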